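(* Let $G$ be a connected graph with $|V(G)|\geq 2$. For any $v \in V(G)$, we have $$1\leq |EM(v)| \leq |V(G)|-1.$$ Moreover, the bounds are sharp (each of the two bounds is attained for some such $G$ and $v$).
   Context: Graphs are finite, undirected and simple. $d_G(x,y)$ is the distance between $x$ and $y$ in $G$, and $G-e$ is the graph obtained from $G$ by deleting the edge $e$ (distances between different components are $\infty$). For a vertex $x$ of $G$, $EM(x)$ is the set of edges $e\in E(G)$ such that there exists a vertex $y\in V(G)$ with $d_G(x,y)\neq d_{G-e}(x,y)$. *)

(* Defs.v *)
From HB Require Import structures.
From mathcomp Require Import all_boot.

Set Implicit Arguments.
Unset Strict Implicit.
Unset Printing Implicit Defensive.

Record sgraph := SGraph {
  vertex :> finType;
  adj : rel vertex;
  adj_sym : symmetric adj;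
  adj_irrefl : irreflexive adj
}.

Definition connected (G : sgraph) : Prop :=
  forall x y : G, connect (@adj G) x y.

Definition edges (G : sgraph) : {set {set G}} :=
  [set e | [exists x : G, exists y : G, adj x y && (e == [set x; y])]].

Section DeleteEdge.
Variables (G : sgraph) (e : {set G}).

Definition del_adj : rel G := [rel x y | adj x y && ([set x; y] != e)].

Lemma del_adj_sym : symmetric del_adj.
Proof. by move=> x y; rewrite /del_adj /= adj_sym setUC. Qed.

Lemma del_adj_irrefl : irreflexive del_adj.
Proof. by move=> x; rewrite /del_adj /= adj_irrefl. Qed.

Definition del_edge : sgraph := SGraph del_adj_sym del_adj_irrefl.

End DeleteEdge.

Section Distance.
Variable G : sgraph.
Implicit Types (x y : G) (n : nat).

Definition walk x y n : bool :=
  [exists p : n.-tuple G, path (@adj G) x p && (last x p == y)].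

Lemma connect_walk x y : connect (@adj G) x y -> exists n, walk x y n.
Proof.
case/connectP=> p px ->; exists (size p).
by apply/existsP; exists (in_tuple p); rewrite px eqxx.
Qed.

Lemma walk_connect x y n : walk x y n -> connect (@adj G) x y.
Proof.
by case/existsP=> p /andP[px /eqP <-]; apply/connectP; exists p.
Qed.

(* [Some n] is the finite distance n, the least length of an x-y walk; [None]
   is the infinite distance between different components. *)
Definition dist x y : option nat :=
  match @idP (connect (@adj G) x y) with
  | ReflectT xy => Some (ex_minn (connect_walk xy))
  | ReflectF _ => None
  end.

Lemma dist_SomeP x y n :
  dist x y = Some n <-> walk x y n /\ (forall m, walk x y m -> n <= m).
Proof.
rewrite /dist; case: {-}_ / idP => [xy | nxy].
  case: ex_minnP => k wk min_k; split=> [[<-] // | [wn min_n]].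
  by congr Some; apply/eqP; rewrite eqn_leq min_k // min_n.
by split=> // -[/walk_connect].
Qed.

Lemma dist_NoneP x y : dist x y = None <-> ~~ connect (@adj G) x y.
Proof.
rewrite /dist; case: {-}_ / idP => [xy | nxy]; first by rewrite xy; split.
by split=> // _; apply/negP.
Qed.

End Distance.

Definition EM (G : sgraph) (x : G) : {set {set G}} :=
  [set e in edges G | [exists y : G, dist x y != @dist (del_edge e) x y]].

(* Main.v *)
Require Import Defs.
From mathcomp Require Import all_boot.

Set Implicit Arguments.
Unset Strict Implicit.
Unset Printing Implicit Defensive.

(* Fix a breadth-first spanning tree rooted at v: every y != v gets a parent
    one step closer to v. Deleting an edge outside this tree keeps all
    distances from v, so EM(v) consists of tree edges and has at most
    |V(G)| - 1 elements. Conversely any edge at v lies in EM(v), since deleting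
    it separates its ends from distance 1. Both bounds equal 1 for the complete
    graph on two vertices. *)

Lemma walk0 (G : sgraph) (x y : G) : walk x y 0 = (x == y).
Proof.
apply/existsP/eqP => [[p] | ->]; first by rewrite tuple0 /= => /eqP.
by exists [tuple]; rewrite /= eqxx.
Qed.

(** Walks are split at their last edge, not their first, so that inductions keep the source [x]
    fixed and move only the endpoint. *)
Lemma walkSP (G : sgraph) (x y : G) (n : nat) :
  reflect (exists2 z, walk x z n & adj z y) (walk x y n.+1).
Proof.
apply: (iffP existsP) => [[[s sz]] /= | [z /existsP[p /andP[px /eqP pz]] zy]].
  case/lastP: s sz => // s t; rewrite size_rcons eqSS => sz.
  rewrite rcons_path last_rcons => /andP[/andP[sx st] /eqP <-].
  by exists (last x s) => //; apply/existsP; exists (Tuple sz); rewrite /= sx eqxx.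
by exists [tuple of rcons p y]; rewrite /= rcons_path last_rcons px pz zy eqxx.
Qed.

Lemma dist_eq0 (G : sgraph) (x y : G) : dist x y = Some 0 -> x = y.
Proof. by case/dist_SomeP; rewrite walk0 => /eqP. Qed.

Lemma connected_dist (G : sgraph) (x y : G) :
  connected G -> exists n, dist x y = Some n.
Proof.
move=> cG; case E: (dist x y) => [n|]; first by exists n.
by move/dist_NoneP: E; rewrite cG.
Qed.

(** The penultimate vertex of a shortest walk works: a walk to it of length below [n], extended by
    one edge, would beat the distance to [y]. *)
Lemma dist_pred (G : sgraph) (x y : G) (n : nat) :
  dist x y = Some n.+1 -> exists2 z, adj z y & dist x z = Some n.
Proof.
case/dist_SomeP => /walkSP[z xz zy] min_n; exists z => //.
apply/dist_SomeP; split=> // m xmz; rewrite -ltnS; apply: min_n.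
by apply/walkSP; exists z.
Qed.

Lemma adj_dist1 (G : sgraph) (x y : G) : dist x y = Some 1 -> adj x y.
Proof. by case/dist_pred => z zy /dist_eq0 ->. Qed.

Lemma dist1_adj (G : sgraph) (x y : G) : adj x y -> dist x y = Some 1.
Proof.
move=> xy; apply/dist_SomeP; split=> [|[|m] //].
  by apply/walkSP; exists x; rewrite ?walk0.
by rewrite walk0 => /eqP yx; rewrite yx adj_irrefl in xy.
Qed.

Lemma walk_del_edge (G : sgraph) (e : {set G}) (x y : G) (n : nat) :
  @walk (del_edge e) x y n -> walk x y n.
Proof.
elim: n y => [|n IHn] y; first by rewrite !walk0.
case/walkSP => z /IHn xz /andP[zy _]; apply/walkSP.
by exists z.
Qed.

Lemma connected_neighbour (G : sgraph) (v : G) :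
  connected G -> 2 <= #|G| -> exists w, adj v w.
Proof.
move=> cG /card_gt1P[a [b [_ _ ab]]].
(* Of the two distinct vertices [a] and [b], at least one differs from [v]. The first step of a path
   to it gives the neighbour. *)
have [y yv] : exists y, v != y.
  by have [va | va] := eqVneq v a; [exists b; rewrite va | exists a].
case/connectP: (cG v y) => [[|w p] /=]; first by move=> _ yE; rewrite yE eqxx in yv.
by case/andP=> vw _ _; exists w.
Qed.

Lemma incident_edge_EM (G : sgraph) (v w : G) :
  adj v w -> [set v; w] \in EM v.
Proof.
move=> vw; rewrite !inE; apply/andP; split.
  by apply/existsP; exists v; apply/existsP; exists w; rewrite vw eqxx.
apply/existsP; exists w; rewrite (dist1_adj vw); apply/eqP => /esym.
by move/adj_dist1 => /andP[_]; rewrite eqxx.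
Qed.

(** [omap S] adds one to a possibly infinite distance. At the root no [z] qualifies, and the default
    makes [v] its own parent. *)
Definition bfs_parent (G : sgraph) (v y : G) : G :=
  odflt y [pick z | adj z y && (dist v y == omap S (dist v z))].

Lemma bfs_parentP (G : sgraph) (v y : G) (n : nat) :
  dist v y = Some n.+1 ->
  adj (bfs_parent v y) y /\ dist v (bfs_parent v y) = Some n.
Proof.
move=> vy; rewrite /bfs_parent vy; case: pickP => [z /andP[zy]|no_z] /=.
  by case: (dist v z) => //= m /eqP[->].
have [z zy vz] := dist_pred vy.
by have := no_z z; rewrite zy vz eqxx.
Qed.

(** The tree path from [v] to [y] has length [n] and survives the deletion, while every walk of the
    smaller graph is a walk of [G], so none is shorter. *)
Lemma dist_del_edge (G : sgraph) (v : G) (e : {set G}) :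
  (forall y, y != v -> [set bfs_parent v y; y] != e) ->
  forall n (y : G), dist v y = Some n -> @dist (del_edge e) v y = Some n.
Proof.
move=> not_tree; have walk_del n y : dist v y = Some n -> @walk (del_edge e) v y n.
  elim: n y => [|n IHn] y vy; first by rewrite walk0 (dist_eq0 vy) eqxx.
  have [py vp] := bfs_parentP vy; apply/walkSP; exists (bfs_parent v y) => /=.
    exact: IHn.
  (* The vertex [y] is not the root: the empty walk from [v] to itself would contradict the positive
     distance. *)
  rewrite /del_adj /= py not_tree //; apply/eqP => yv; rewrite yv in vy.
  by case/dist_SomeP: vy => _ /(_ 0); rewrite walk0 eqxx => /(_ isT).
move=> n y vy; apply/dist_SomeP; split; first exact: walk_del.
by move=> m /walk_del_edge; case/dist_SomeP: vy => _; apply.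
Qed.

Lemma EM_sub_bfs_tree (G : sgraph) (v : G) : connected G ->
  EM v \subset [set [set bfs_parent v y; y] | y in [set~ v]].
Proof.
move=> cG; apply/subsetP => e; rewrite inE => /andP[_ /existsP[y]].
(* Contrapositive: if [e] is not a tree edge, no [y] sees a change. Connectedness makes the distance
   to [y] finite. *)
apply: contraNT => not_tree; have [n vy] := @connected_dist G v y cG.
rewrite vy eq_sym; apply/eqP/dist_del_edge => // z zv.
apply: contraNneq not_tree => <-.
by apply/imsetP; exists z; rewrite // !inE.
Qed.

Lemma card_EM_bounds (G : sgraph) (v : G) :
  connected G -> 2 <= #|G| -> 1 <= #|EM v| <= #|G| - 1.
Proof.
move=> cG G2; apply/andP; split.
  have [w vw] := connected_neighbour v cG G2.
  by apply/card_gt0P; exists [set v; w]; apply: incident_edge_EM.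
apply: leq_trans (subset_leq_card (EM_sub_bfs_tree v cG)) _.
by apply: leq_trans (leq_imset_card _ _) _; rewrite cardsC1 subn1.
Qed.

Lemma K2_sym : symmetric (fun x y : bool => x != y).
Proof. by move=> x y; rewrite eq_sym. Qed.

Lemma K2_irrefl : irreflexive (fun x y : bool => x != y).
Proof. by move=> x; rewrite eqxx. Qed.

Definition K2 : sgraph := SGraph K2_sym K2_irrefl.

Lemma K2_connected : connected K2.
Proof.
move=> x y; have [-> | xy] := eqVneq x y; first exact: connect0.
exact: connect1.
Qed.

Lemma card_EM_K2 (v : K2) : #|EM v| = 1.
Proof.
(* For two vertices the general bounds read 1 and 2 - 1, so they pinch the cardinality. *)
apply/eqP; rewrite eqn_leq andbC.
by have := @card_EM_bounds K2 v K2_connected; rewrite card_bool; apply.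
Qed.

Theorem proposition4p1 :
  (forall G : sgraph, connected G -> 2 <= #|G| ->
     forall v : G, 1 <= #|EM v| <= #|G| - 1)
  /\ (exists G : sgraph,
        [/\ connected G, 2 <= #|G| & exists v : G, #|EM v| = 1])
  /\ (exists G : sgraph,
        [/\ connected G, 2 <= #|G| & exists v : G, #|EM v| = #|G| - 1]).
Proof.
split; first by move=> G cG G2 v; apply: card_EM_bounds.
split; exists K2; split; rewrite ?card_bool //; try exact: K2_connected.
  by exists true; apply: card_EM_K2.
by exists true; rewrite card_EM_K2.
Qed.
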